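(* Let $(a_n)\in\mathbb{C}^{\mathbb{N}}$ be a sequence and let $L\in\mathbb{C}$. Then $\lim_{n\to\infty}a_n=L$ if and only if ${}^*a_n\approx L$ for all $n\in{}^*\mathbb{N}\setminus\mathbb{N}$.
   Context: $\mathbb{R}_+$ is the set of positive real numbers and $\mathbb{N}=\{1,2,3,\dots\}$. Fix an ultrafilter $\mathcal{U}$ on $\mathbb{R}_+$ such that $(0,\tfrac1n)\in\mathcal{U}$ for all $n\in\mathbb{N}$. A property of $\varepsilon\in\mathbb{R}_+$ holds almost everywhere (a.e.) if the set of $\varepsilon$ for which it holds belongs to $\mathcal{U}$. For nets $(a_\varepsilon),(b_\varepsilon)\in\mathbb{C}^{\mathbb{R}_+}$ write $(a_\varepsilon)\sim(b_\varepsilon)$ if $a_\varepsilon=b_\varepsilon$ a.e.; $\langle a_\varepsilon\rangle$ is the equivalence class, and ${}^*\mathbb{C}=\mathbb{C}^{\mathbb{R}_+}/\!\sim$ with operations induced pointwise; $\mathbb{C}$ is embedded via constant nets; $|\langle z_\varepsilon\rangle|=\langle|z_\varepsilon|\rangle$. For $S\subseteq\mathbb{C}$, ${}^*S=\{\langle s_\varepsilon\rangle : s_\varepsilon\in S\text{ a.e.}\}$; this defines ${}^*\mathbb{N}$ and ${}^*\mathbb{R}$, the latter ordered by $\langle a_\varepsilon\rangle<\langle b_\varepsilon\rangle$ iff $a_\varepsilon<b_\varepsilon$ a.e. A sequence $(a_n)$ is viewed as a function $f:\mathbb{N}\to\mathbb{C}$, $f(n)=a_n$, and for $n=\langle n_\varepsilon\rangle\in{}^*\mathbb{N}$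 (with representative chosen so that $n_\varepsilon\in\mathbb{N}$ for all $\varepsilon$), ${}^*a_n={}^*f(n)=\langle f(n_\varepsilon)\rangle$. $z\in{}^*\mathbb{C}$ is infinitesimal if $|z|<\tfrac1m$ for all $m\in\mathbb{N}$; $a\approx b$ means $a-b$ is infinitesimal. *)

(* Defs.v *)
(* World: MathComp-Analysis. R[i]^o is R[i] with its norm topology. *)
From HB Require Import structures.
From mathcomp Require Import all_boot all_order all_algebra.
From mathcomp Require Import complex.
From mathcomp Require Import all_classical all_reals all_analysis.

Set Implicit Arguments.
Unset Strict Implicit.
Unset Printing Implicit Defensive.

Import Order.TTheory GRing.Theory Num.Theory.
Import numFieldNormedType.Exports.

Local Open Scope classical_set_scope.
Local Open Scope ring_scope.
Local Open Scope complex_scope.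
Local Open Scope quotient_scope.

Section Hypercomplex.
Context {R : realType} (U : set_system {posnum R}) {hU : UltraFilter U}.

Definition net : Type := {posnum R} -> R[i].
HB.instance Definition _ := Choice.on net.

Definition net_eq (u v : net) : bool := `[< \forall e \near U, u e = v e >].

Lemma net_eq_equiv : equiv_class_of net_eq.
Proof.
split=> [u|u v|v u w].
- by apply/asboolP; near=> e.
- by apply/asboolP/asboolP => uv; near do apply/esym.
- move=> /asboolP uv /asboolP vw; apply/asboolP.
  by near=> e; transitivity (v e); near: e.
Unshelve. all: by end_near. Qed.

Canonical net_equiv := EquivRelPack net_eq_equiv.

Definition starC := {eq_quot net_equiv}.
HB.instance Definition _ := Choice.on starC.
HB.instance Definition _ := EqQuotient.on starC.

Definition cls (u : net) : starC := \pi_starC u.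

Lemma clsP (u v : net) : cls u = cls v <-> \forall e \near U, u e = v e.
Proof.
split=> [/eqquotP/asboolP //|uv].
by apply/eqquotP/asboolP.
Qed.

Lemma clsK (z : starC) : cls (repr z) = z.
Proof. exact: reprK. Qed.

Definition lift1 (f : R[i] -> R[i]) (x : starC) : starC :=
  cls (fun e => f (repr x e)).

Definition lift2 (f : R[i] -> R[i] -> R[i]) (x y : starC) : starC :=
  cls (fun e => f (repr x e) (repr y e)).

Lemma near_repr_cls (u : net) : \forall e \near U, repr (cls u) e = u e.
Proof. by apply/clsP; rewrite clsK. Qed.

Lemma lift1E f (u : net) : lift1 f (cls u) = cls (fun e => f (u e)).
Proof.
by apply/clsP; have := near_repr_cls u; apply: filterS => e ->.
Qed.

Lemma lift2E f (u v : net) :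
  lift2 f (cls u) (cls v) = cls (fun e => f (u e) (v e)).
Proof.
apply/clsP; have := near_repr_cls u; have := near_repr_cls v.
by apply: filterS2 => e -> ->.
Qed.

Definition stdC (z : R[i]) : starC := cls (fun=> z).

Let addC := lift2 +%R.
Let oppC := lift1 -%R.
Let mulC := lift2 *%R.

Let addCA : associative addC.
Proof.
move=> x y z; rewrite -(clsK x) -(clsK y) -(clsK z) /addC !lift2E.
by congr cls; apply/funext => e; rewrite addrA.
Qed.

Let addCC : commutative addC.
Proof.
move=> x y; rewrite -(clsK x) -(clsK y) /addC !lift2E.
by congr cls; apply/funext => e; rewrite addrC.
Qed.

Let add0C : left_id (stdC 0) addC.
Proof.
move=> x; rewrite -(clsK x) /addC lift2E.
by congr cls; apply/funext => e; rewrite add0r.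
Qed.

Let addNC : left_inverse (stdC 0) oppC addC.
Proof.
move=> x; rewrite -(clsK x) /addC /oppC lift1E lift2E.
by congr cls; apply/funext => e; rewrite addNr.
Qed.

HB.instance Definition _ :=
  GRing.isZmodule.Build starC addCA addCC add0C addNC.

Let mulCA : associative mulC.
Proof.
move=> x y z; rewrite -(clsK x) -(clsK y) -(clsK z) /mulC !lift2E.
by congr cls; apply/funext => e; rewrite mulrA.
Qed.

Let mulCC : commutative mulC.
Proof.
move=> x y; rewrite -(clsK x) -(clsK y) /mulC !lift2E.
by congr cls; apply/funext => e; rewrite mulrC.
Qed.

Let mul1C : left_id (stdC 1) mulC.
Proof.
move=> x; rewrite -(clsK x) /mulC lift2E.
by congr cls; apply/funext => e; rewrite mul1r.
Qed.

Let mulCDl : left_distributive mulC addC.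
Proof.
move=> x y z; rewrite -(clsK x) -(clsK y) -(clsK z) /mulC /addC !lift2E.
by congr cls; apply/funext => e; rewrite mulrDl.
Qed.

Let oneC_neq0 : stdC 1 != stdC 0.
Proof.
apply/eqP => /clsP h; apply: (@filter_not_empty _ U _).
by apply: filterS h => e /eqP; rewrite oner_eq0.
Qed.

HB.instance Definition _ := GRing.Zmodule_isComNzRing.Build starC
  mulCA mulCC mul1C mulCDl oneC_neq0.

Lemma cls_add (u v : net) : cls u + cls v = cls (fun e => u e + v e).
Proof. exact: lift2E. Qed.

Lemma cls_opp (u : net) : - cls u = cls (fun e => - u e).
Proof. exact: lift1E. Qed.

Lemma cls_mul (u v : net) : cls u * cls v = cls (fun e => u e * v e).
Proof. exact: lift2E. Qed.

Definition star_norm : starC -> starC := lift1 (fun z => `|z|).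

Definition star_set (S : set R[i]) : set starC :=
  [set z | exists s : net, (\forall e \near U, S (s e)) /\ z = cls s].

Definition std_set (S : set R[i]) : set starC := [set stdC z | z in S].

Definition CN : set R[i] := [set z | exists2 n : nat, (0 < n)%N & z = n%:R].

Definition CR : set R[i] := [set x%:C | x in [set: R]].

Definition starN : set starC := star_set CN.
Definition starR : set starC := star_set CR.

(* The order of the hyperreals; it relates no other elements of starC. *)
Definition starR_lt (x y : starC) : Prop :=
  exists u v : {posnum R} -> R,
    [/\ x = cls (fun e => (u e)%:C), y = cls (fun e => (v e)%:C)
      & \forall e \near U, u e < v e].

Lemma starR_ltE (u v : {posnum R} -> R) :
  starR_lt (cls (fun e => (u e)%:C)) (cls (fun e => (v e)%:C)) <->
  \forall e \near U, u e < v e.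
Proof.
split=> [[u' [v' [/clsP uu' /clsP vv' uv]]]|uv]; last by exists u, v.
near=> e.
have -> : u e = u' e by apply: (@complexI R); near: e.
have -> : v e = v' e by apply: (@complexI R); near: e.
by near: e.
Unshelve. all: by end_near. Qed.

Lemma star_norm_starR (z : starC) : starR (star_norm z).
Proof.
exists (fun e => `|repr z e|); split=> //.
by near=> e; exists (complex.Re `|repr z e|); rewrite //= RRe_real // normr_real.
Unshelve. all: by end_near. Qed.

Definition infinitesimal (z : starC) : Prop :=
  forall m : nat, (0 < m)%N -> starR_lt (star_norm z) (stdC m%:R^-1).

Definition infinitely_close (x y : starC) : Prop := infinitesimal (x - y).

(* A representative of n all of whose values are positive integers; it exists
   when n is in starN, and the default value is a dummy for other n. *)
Definition nat_repr (n : starC) : {posnum R} -> nat :=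
  xget (fun=> 1%N)
    [set k : {posnum R} -> nat |
      (forall e, (0 < k e)%N) /\ n = cls (fun e => (k e)%:R)].

(* A sequence indexed by {1, 2, ...} is a function on nat whose value at 0 is
   never used. *)
Definition star_seq (a : nat -> R[i]) (n : starC) : starC :=
  cls (fun e => a (nat_repr n e)).

Lemma nat_reprP (n : starC) : starN n ->
  (forall e, (0 < nat_repr n e)%N) /\ n = cls (fun e => (nat_repr n e)%:R).
Proof.
move=> [s [sN ->]]; rewrite /nat_repr; case: xgetP => [k _ //|H]; exfalso.
pose k e := xget 1%N [set j : nat | (0 < j)%N /\ s e = j%:R].
apply: (H k); split=> [e|].
  by rewrite /k; case: xgetP => [j _ []|].
apply/clsP; apply: filterS sN => e [j j0 sj]; rewrite /k.
by case: xgetP => [i _ []//|/(_ j)[]].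
Qed.

Lemma star_seqE (a : nat -> R[i]) (k : {posnum R} -> nat) :
  (forall e, (0 < k e)%N) ->
  star_seq a (cls (fun e => (k e)%:R)) = cls (fun e => a (k e)).
Proof.
move=> k0; have kN : starN (cls (fun e => (k e)%:R)).
  exists (fun e => (k e)%:R); split=> //.
  by near=> e; exists (k e).
have [_ /clsP kk] := nat_reprP kN.
apply/clsP; apply: filterS kk => e /eqP.
by rewrite eqr_nat => /eqP <-.
Unshelve. all: by end_near. Qed.

End Hypercomplex.

Arguments cls {R} U {hU} u.
Arguments stdC {R} U {hU} z.
Arguments starC {R} U {hU}.
Arguments starN {R} U {hU}.
Arguments starR {R} U {hU}.
Arguments std_set {R} U {hU} S.
Arguments star_set {R} U {hU} S.

(* Main.v *)
(* A positive hypernatural <k_e> is nonstandard iff k tends to infinity along U: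
   if each set {k = j} is U-null, then so are their finite unions {k < N}.
   Composing with such a k transports convergence of a to U. Conversely, if a
   does not converge to L, pick f n > n with a (f n) at distance at least 1/m
   from L; then k_e = f (trunc (1/e)) is nonstandard since e is infinitesimal,
   and a at <k_e> is not infinitely close to L. *)
Require Import Defs.
From mathcomp Require Import all_boot all_order all_algebra.
From mathcomp Require Import complex.
From mathcomp Require Import all_classical all_reals all_analysis.
Import Order.TTheory GRing.Theory Num.Theory.
Import numFieldNormedType.Exports.
Local Open Scope classical_set_scope.
Local Open Scope ring_scope.
Local Open Scope complex_scope.

Lemma infinitesimal_cls (R : realType) (U : set_system {posnum R})
    (hU : UltraFilter U) (u : {posnum R} -> R[i]) :
  infinitesimal (cls U u) <->
  forall m : nat, (0 < m)%N -> \forall e \near U, `|u e| < m%:R^-1.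
Proof.
have normE : star_norm (cls U u) = cls U (fun e => (complex.Re `|u e|)%:C).
  by rewrite /star_norm lift1E.
have invE (m : nat) : (m%:R^-1 : R[i]) = (m%:R^-1)%:C.
  by rewrite fmorphV rmorph_nat.
split=> h m /h.
- rewrite normE /stdC invE => /starR_ltE; apply: filterS => e.
  by rewrite -ltcR RRe_real.
- move=> um; rewrite normE /stdC invE; apply/starR_ltE.
  by apply: filterS um => e ue; rewrite -ltcR -invE RRe_real.
Qed.

Lemma cvg_complex_invn (R : realType) (a : nat -> R[i]) (L : R[i]) :
  ((a : nat -> R[i]^o) @ \oo --> (L : R[i]^o)) <->
  (forall m : nat, (0 < m)%N -> \forall n \near \oo, `|a n - L| < m%:R^-1).
Proof.
split=> [/cvgrPdistC_lt h m m0|h].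
  by apply: h; rewrite invr_gt0 ltr0n.
apply/cvgrPdistC_lt => eps eps0.
have epsE : (complex.Re eps)%:C = eps by rewrite RRe_real // gtr0_real.
have Re0 : 0 < complex.Re eps by rewrite -ltcR epsE.
have [m hm] : exists m : nat, (m.+1%:R^-1 : R) < complex.Re eps.
  exists (Num.truncn (complex.Re eps)^-1).
  by rewrite invf_plt ?posrE // truncnS_gt.
near=> n; apply: (@lt_trans _ _ (m.+1%:R^-1)); first by near: n; exact: h.
by move: hm; rewrite -ltcR epsE fmorphV rmorph_nat.
Unshelve. all: by end_near. Qed.

Lemma nonstd_natP (R : realType) (U : set_system {posnum R})
    (hU : UltraFilter U) (k : {posnum R} -> nat) (k0 : forall e, (0 < k e)%N) :
  ~ std_set U (@CN R) (cls U (fun e => (k e)%:R)) <->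
  k @ U --> \oo.
Proof.
split=> [kns|koo [_ [j j0 ->] /clsP kj]]; last first.
  apply: (@filter_not_empty _ U _).
  have jk : \forall e \near U, (j < k e)%N by exact: koo (nbhs_infty_gt j).
  apply: filterS2 kj jk => e /eqP.
  by rewrite eqr_nat => /eqP <-; rewrite ltnn.
have kN N : \forall e \near U, (N <= k e)%N.
  elim: N => [|N IH]; first by near=> e.
  have [kN|kN] := in_ultra_setVsetC [set e | k e = N] hU; last first.
    by apply: filterS2 IH kN => e; rewrite leq_eqVlt => /orP[/eqP-> []|].
  exfalso; apply: kns; exists N%:R; last first.
    by apply/clsP; apply: filterS kN => e ->.
  exists N => //.
  by have [e <-] := filter_ex kN.
by move=> A [N _ NA]; apply: filterS (kN N) => e /NA.
Unshelve. all: by end_near. Qed.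

Lemma trunc_inv_cvg (R : realType) (U : set_system {posnum R})
    (hU : UltraFilter U)
    (hU0 : forall n : nat, (0 < n)%N ->
       U [set e : {posnum R} | e%:num < n%:R^-1]) :
  (fun e : {posnum R} => Num.truncn (e%:num^-1)) @ U --> \oo.
Proof.
move=> A [N _ NA]; apply: (@filterS _ U) (hU0 N.+1 isT) => e eN; apply: NA => /=.
rewrite truncn_ge_nat //; apply: ltW; apply: (@lt_trans _ _ N.+1%:R).
  by rewrite ltr_nat.
by rewrite -ltf_pV2 ?posrE // invrK.
Qed.

Theorem corollary4p2p4 (R : realType) (U : set_system {posnum R})
    (hU : UltraFilter U)
    (hU0 : forall n : nat, (0 < n)%N ->
       U [set e : {posnum R} | e%:num < n%:R^-1])
    (a : nat -> R[i]) (L : R[i]) :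
  ((a : nat -> R[i]^o) @ \oo --> (L : R[i]^o)) <->
  (forall n : starC U, (starN U `\` std_set U (@CN R)) n ->
     infinitely_close (star_seq a n) (stdC U L)).
Proof.
have closeP (k : {posnum R} -> nat) : (forall e, (0 < k e)%N) ->
    infinitely_close (star_seq a (cls U (fun e => (k e)%:R))) (stdC U L) <->
    forall m : nat, (0 < m)%N -> \forall e \near U, `|a (k e) - L| < m%:R^-1.
  move=> k0; rewrite /infinitely_close star_seqE // /stdC cls_opp cls_add.
  exact: infinitesimal_cls.
rewrite cvg_complex_invn; split=> [aL n [/nat_reprP[k0 ->]]|h m m0].
  move=> /(nonstd_natP _ _ _ _ k0) koo; apply/closeP => // m m0.
  exact: koo (aL m m0).
apply: contrapT => nconv.
have far N : exists n, (N < n)%N /\ ~ (`|a n - L| < m%:R^-1).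
  apply: contrapT => /forallNP nN; apply: nconv; exists N.+1 => // n /= Nn.
  by apply: contrapT => nlt; apply: (nN n).
have [f /all_and2[fN ffar]] := choice far.
pose k (e : {posnum R}) := f (Num.truncn (e%:num^-1)).
have k0 e : (0 < k e)%N by apply: leq_ltn_trans (fN _).
have koo : k @ U --> \oo.
  move=> A [N _ NA].
  apply: (@filterS _ U) (trunc_inv_cvg _ _ _ hU0 _ (nbhs_infty_ge N)) => e Ne.
  by apply: NA; apply: leq_trans Ne (ltnW (fN _)).
apply: (@filter_not_empty _ U _).
have /closeP/(_ m m0) : infinitely_close
    (star_seq a (cls U (fun e => (k e)%:R))) (stdC U L).
  apply: h; split; last exact/nonstd_natP.
  by exists (fun e => (k e)%:R); split=> //; near=> e; exists (k e).
by move=> /(_ k0); apply: filterS => e /ffar.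
Unshelve. all: by end_near. Qed.
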